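(* Let $\{T(t)\}_{t\ge0}$ be a bounded $C_0$-semigroup with generator $A$ on a Banach space $X$, and let $C^{\odot}(r)=\frac1r\int_0^rT^{\odot}(s)\,ds$ for $r>0$. Then there is a net $\{r_\lambda\}_{\lambda\in\Lambda}\subset(0,\infty)$ such that for every $x^{\odot}\in X^{\odot}$ the limit $\sigma(X^{\odot},X)\text{-}\lim_{\lambda}C^{\odot}(r_\lambda)x^{\odot}$ exists and lies in $N(A^{\odot})$, and $Q^{\odot}:=\kappa^{\odot}\text{-}\lim_{\lambda}C^{\odot}(r_\lambda)$ is a projection of $X^\odot$ onto $N(A^{\odot})$.
   Context: $X^{\odot}=\{x^*\in X^*:\lim_{t\to0}\|T^*(t)x^*-x^*\|=0\}$ is a norm-closed, weak*-dense, $T^*(t)$-invariant subspace of $X^*$; $T^{\odot}(t)=T^*(t)|_{X^{\odot}}$ is a $C_0$-semigroup on $X^\odot$ with generator $A^\odot$ (the part of $A^*$ in $X^\odot$). $N(\cdot)$ denotes the kernel. The topology $\kappa^{\odot}$ on $L(X^\odot)$: $V_\lambda\to V$ iff $\langle V_\lambda x^\odot,x\rangle\to\langle Vx^\odot,x\rangle$ for all $x\in X$, $x^\odot\in X^\odot$. *)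

(* Defs.v *)
From HB Require Import structures.
From mathcomp Require Import all_boot all_order all_algebra.
From mathcomp Require Import complex.
From mathcomp Require Import all_classical all_reals all_analysis.

Set Implicit Arguments.
Unset Strict Implicit.
Unset Printing Implicit Defensive.

Import Order.TTheory GRing.Theory Num.Theory.
Import numFieldNormedType.Exports.

Local Open Scope classical_set_scope.
Local Open Scope ring_scope.

(** Banach spaces are over the scalar field [scalar_field R k], that is, over the
    real numbers or over the complex numbers; time is always real. *)
Variant scalar_kind := RealScalars | ComplexScalars.

Definition scalar_field (R : realType) (k : scalar_kind) : numFieldType :=
  match k with RealScalars => R | ComplexScalars => R[i] end.

Definition of_real (R : realType) (k : scalar_kind) :
    {rmorphism R -> scalar_field R k} :=
  match k with
  | RealScalars => idfun
  | ComplexScalars => real_complex R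
  end.

Lemma cvg_initial (S : choiceType) (T : topologicalType) (f : S -> T)
    (F : set_system S) (x : S) : Filter F ->
  F --> (x : initial_topology f) <-> f @ F --> f x.
Proof.
move=> FF; split=> [Fx A /initial_continuous|fF A]; first exact: Fx.
by move=> [_ /= [[B oB <-] /= Bfx]] BA; apply: filterS BA _; apply/fF/open_nbhs_nbhs.
Qed.

Lemma cvg_ptws (I : Type) (T : topologicalType) (F : set_system (I -> T))
    (f : I -> T) : Filter F ->
  F --> (f : {ptws I -> T}) <-> forall i, g i @[g --> F] --> f i.
Proof.
move=> FF; rewrite cvg_sup; split=> Ff i.
  by apply/(@cvg_initial _ _ (fun g : I -> T => g i)); exact: Ff.
by apply/(@cvg_initial _ _ (fun g : I -> T => g i)); exact: Ff.
Qed.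

Section OfReal.
Context (R : realType) (k : scalar_kind).
Local Notation K := (scalar_field R k).
Local Notation of_real := (of_real R k).

Lemma ler_of_real (x y : R) : (of_real x <= of_real y) = (x <= y).
Proof. by case: k => //=; rewrite lecR. Qed.

Lemma of_real_ge0 (x : R) : (0 <= of_real x) = (0 <= x).
Proof. by rewrite -{1}(rmorph0 of_real) ler_of_real. Qed.

Lemma ge0_of_real (c : K) : 0 <= c -> exists2 r : R, 0 <= r & c = of_real r.
Proof.
case: k c => [c c0|[a b]].
  by exists c.
by move=> /= /andP[/eqP/= b0 a0]; exists a => //; rewrite b0.
Qed.

End OfReal.

Section BoundedLinear.
Context (R : realType) (k : scalar_kind).
Local Notation K := (scalar_field R k).
Local Notation of_real := (of_real R k).
Variables (X Y : normedModType K).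

Definition blin_pred : {pred X -> Y} :=
  [pred f | `[< linear f /\ continuous f >]].

Lemma blin_predP f : reflect (linear f /\ continuous f) (f \in blin_pred).
Proof. by apply: (iffP idP) => /asboolP. Qed.

Lemma blin_submod_closed : submod_closed blin_pred.
Proof.
split.
- apply/blin_predP; split; last exact: cst_continuous.
  by move=> a x y; change (0 = a *: 0 + 0 :> Y); rewrite scaler0 addr0.
- move=> a f g /blin_predP[lf cf] /blin_predP[lg cg].
  apply/blin_predP; split=> [b x y|x].
    by rewrite !fctE lf lg !scalerDr !scalerA (mulrC a) addrACA.
  by apply: cvgD; [apply: cvgZr; exact: cf | exact: cg].
Qed.

HB.instance Definition _ :=
  GRing.isSubmodClosed.Build K (X -> Y) blin_pred blin_submod_closed.

(** [L(X, Y)], with the operator norm. *)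
Record blin := Blin { blin_fun :> X -> Y; blinP : blin_fun \in blin_pred }.

HB.instance Definition _ := [isSub for blin_fun].
HB.instance Definition _ := [Choice of blin by <:].
HB.instance Definition _ := [SubChoice_isSubLmodule of blin by <:].

Definition mk_blin (f : X -> Y) (lf : linear f) (cf : continuous f) : blin :=
  @Blin f (introT (blin_predP f) (conj lf cf)).

Lemma blin_linear (f : blin) : linear f.
Proof. by have /blin_predP[] := blinP f. Qed.

HB.instance Definition _ (f : blin) :=
  GRing.isLinear.Build K X Y _ (blin_fun f) (blin_linear f).

Lemma blin_continuous (f : blin) : continuous f.
Proof. by have /blin_predP[] := blinP f. Qed.

Lemma blin_eqP (f g : blin) : f =1 g -> f = g.
Proof. by move=> fg; apply/val_inj/funext. Qed.

Definition unit_values (f : blin) : set R :=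
  [set r | exists2 x, `|x| <= 1 & of_real r = `|f x| ].

Definition opnorm (f : blin) : R := sup (unit_values f).

Lemma unit_values_has_sup (f : blin) : has_sup (unit_values f).
Proof.
split; first by exists 0, 0; rewrite ?normr0 ?ler01// linear0 normr0 rmorph0.
have /linear_bounded_continuous/linear_boundedP := @blin_continuous f.
move=> /pinfty_ex_gt0[M M0 fM].
have [m m0 Mm] := ge0_of_real (ltW M0).
exists m => r [x x1 rx]; rewrite -(ler_of_real k) rx -Mm.
by apply: (le_trans (fM x)); rewrite ler_piMr// ltW.
Qed.

Lemma opnorm_ge0 (f : blin) : 0 <= opnorm f.
Proof.
apply: ub_le_sup; first by case: (unit_values_has_sup f).
by exists 0; rewrite ?normr0 ?ler01// linear0 normr0 rmorph0.
Qed.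

Lemma le_opnorm (f : blin) x : `|f x| <= of_real (opnorm f) * `|x|.
Proof.
have [->|x0] := eqVneq x 0; first by rewrite linear0 !normr0 mulr0.
have nx0 : 0 < `|x| by rewrite normr_gt0.
rewrite -ler_pdivrMr//.
have E : `|f x| / `|x| = `|f (`|x|^-1 *: x)|.
  by rewrite linearZ/= normrZ normfV normr_id mulrC.
have [r r0 rE] := ge0_of_real (normr_ge0 (f (`|x|^-1 *: x))).
rewrite E rE ler_of_real; apply: ub_le_sup.
  by case: (unit_values_has_sup f).
by exists (`|x|^-1 *: x) => //; rewrite normrZ normfV normr_id mulVf// gt_eqF.
Qed.

Lemma opnorm_le (f : blin) (M : R) : 0 <= M ->
  (forall x, `|f x| <= of_real M * `|x|) -> opnorm f <= M.
Proof.
move=> M0 fM; apply: ge_sup; first by case: (unit_values_has_sup f).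
move=> r [x x1 rx]; rewrite -(ler_of_real k) rx.
by apply: (le_trans (fM x)); rewrite ler_piMr// of_real_ge0.
Qed.

Definition blin_norm (f : blin) : K := of_real (opnorm f).

Lemma blin_normD f g : blin_norm (f + g) <= blin_norm f + blin_norm g.
Proof.
rewrite /blin_norm -rmorphD ler_of_real; apply: opnorm_le.
  by rewrite addr_ge0 ?opnorm_ge0.
move=> x; apply: (le_trans (ler_normD (f x) (g x))).
by rewrite rmorphD mulrDl lerD ?le_opnorm.
Qed.

Lemma blin_normZ (a : K) f : blin_norm (a *: f) = `|a| * blin_norm f.
Proof.
have le b g : blin_norm (b *: g) <= `|b| * blin_norm g.
  have [r r0 br] := ge0_of_real (normr_ge0 b).
  rewrite /blin_norm br -rmorphM ler_of_real; apply: opnorm_le.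
    by rewrite mulr_ge0 ?opnorm_ge0.
  move=> x; rewrite -[(b *: g) x]/(b *: g x) normrZ br rmorphM -mulrA.
  by rewrite ler_wpM2l ?of_real_ge0 ?le_opnorm.
apply/eqP; rewrite eq_le le /=.
have [->|a0] := eqVneq a 0.
  by rewrite normr0 mul0r of_real_ge0 opnorm_ge0.
have := le a^-1 (a *: f).
by rewrite scalerA mulVf// scale1r normfV ler_pdivlMl ?normr_gt0.
Qed.

Lemma blin_norm0 f : blin_norm f = 0 -> f = 0.
Proof.
rewrite /blin_norm => f0; apply: blin_eqP => x.
by apply/normr0_eq0/le_anti; rewrite normr_ge0 (le_trans (le_opnorm f x))// f0 mul0r.
Qed.

HB.instance Definition _ :=
  Lmodule_isNormed.Build K blin blin_normD blin_normZ blin_norm0.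

Lemma blin_normE (f : blin) : `|f| = of_real (opnorm f).
Proof. by []. Qed.

End BoundedLinear.

Section Semigroup.
Context (R : realType) (k : scalar_kind).
Local Notation K := (scalar_field R k).
Local Notation of_real := (of_real R k).

(** Only the operators [S t] with [0 <= t] matter: for [t < 0] they are
    arbitrary. *)
Record C0semigroup (Y : normedModType K) := C0Semigroup {
  semigroup_op :> R -> blin Y Y;
  semigroup0 : forall y, semigroup_op 0 y = y;
  semigroupD : forall s t y, 0 <= s -> 0 <= t ->
    semigroup_op (s + t) y = semigroup_op s (semigroup_op t y);
  semigroup_cvg : forall y, semigroup_op t y @[t --> 0^'+] --> y }.

Definition bounded_semigroup (Y : normedModType K) (S : C0semigroup Y) :=
  exists M : K, forall t, 0 <= t -> `|S t| <= M.

(** The generator is an unbounded operator, given by its graph: [generator S y z]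
    means that [y] is in its domain and is mapped to [z]. *)
Definition generator (Y : normedModType K) (S : C0semigroup Y) (y z : Y) :=
  (of_real h)^-1 *: (S h y - y) @[h --> 0^'+] --> z.

Definition null_space (Y : normedModType K) (A : Y -> Y -> Prop) : set Y :=
  [set y | A y 0].

(** Riemann integral: [I] is the limit of the tagged Riemann sums of [f] over
    the subdivisions [a = s 0 <= ... <= s n = b], as the mesh tends to 0. *)
Definition is_Riemann_integral (Y : normedModType K) (f : R -> Y) (a b : R)
    (I : Y) :=
  forall e : R, 0 < e -> exists2 d : R, 0 < d &
    forall (n : nat) (s xi : nat -> R), s 0%N = a -> s n = b ->
      (forall i, (i < n)%N -> s i <= xi i <= s i.+1) ->
      (forall i, (i < n)%N -> s i.+1 - s i < d) ->
      `|\sum_(i < n) of_real (s i.+1 - s i) *: f (xi i) - I| < of_real e.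

(** The operator [C(r) : y |-> r^-1 * \int_0^r S(s) y ds] of [L(Y, Y)]. For
    [0 < r] it is unique, and it exists when [Y] is complete (as [X^\odot] is),
    since [s |-> S(s) y] is then norm continuous on [[0, r]]; otherwise the
    value is the default [0]. *)
Definition cesaro_mean (Y : normedModType K) (S : C0semigroup Y) (r : R) : blin Y Y :=
  xget 0 [set C : blin Y Y | forall y, exists2 I,
    is_Riemann_integral (fun s => S s y) 0 r I & C y = (of_real r)^-1 *: I].

End Semigroup.

Section Dual.
Context (R : realType) (k : scalar_kind).
Local Notation K := (scalar_field R k).

Definition dual_space (X : normedModType K) : normedModType K := blin X K^o.

Variable X : normedModType K.

Lemma adjoint_linear (S : blin X X) (phi : dual_space X) :
  linear (fun x => phi (S x) : K^o).
Proof. by move=> a x y; rewrite blin_linear linearP. Qed.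

Lemma adjoint_continuous (S : blin X X) (phi : dual_space X) :
  continuous (fun x => phi (S x) : K^o).
Proof. by move=> x; apply: continuous_comp; exact: blin_continuous. Qed.

Definition adjoint (S : blin X X) (phi : dual_space X) : dual_space X :=
  mk_blin (@adjoint_linear S phi) (@adjoint_continuous S phi).

Lemma adjointP (S : blin X X) a (phi psi : dual_space X) :
  adjoint S (a *: phi + psi) = a *: adjoint S phi + adjoint S psi.
Proof. exact: blin_eqP. Qed.

Lemma adjoint_norm (S : blin X X) (phi : dual_space X) :
  `|adjoint S phi| <= `|S| * `|phi|.
Proof.
rewrite !blin_normE -rmorphM ler_of_real; apply: opnorm_le.
  by rewrite mulr_ge0 ?opnorm_ge0.
move=> x; apply: (le_trans (le_opnorm phi (S x))).
by rewrite mulrC rmorphM mulrAC ler_wpM2r ?of_real_ge0 ?opnorm_ge0 ?le_opnorm.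
Qed.

End Dual.

Section Sun.
Context (R : realType) (k : scalar_kind).
Local Notation K := (scalar_field R k).
Variables (X : normedModType K) (T : C0semigroup X).

Definition sun_pred : {pred dual_space X} :=
  [pred phi | `[< adjoint (T t) phi @[t --> 0^'+] --> phi >]].

Lemma sun_predP (phi : dual_space X) :
  reflect (adjoint (T t) phi @[t --> 0^'+] --> phi) (phi \in sun_pred).
Proof. by apply: (iffP idP) => /asboolP. Qed.

Lemma sun_submod_closed : submod_closed sun_pred.
Proof.
split.
- apply/sun_predP; rewrite (_ : (fun t => _) = cst 0); first exact: cvg_cst.
  by apply/funext => t; apply: blin_eqP.
- move=> a phi psi /sun_predP phiP /sun_predP psiP; apply/sun_predP.
  under eq_fun do rewrite adjointP.
  by apply: cvgD => //; exact: cvgZr.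
Qed.

HB.instance Definition _ :=
  GRing.isSubmodClosed.Build K (dual_space X) sun_pred sun_submod_closed.

(** [X^\odot], with the norm of the dual space. *)
Record sun := Sun { sun_val :> dual_space X; sunP : sun_val \in sun_pred }.

HB.instance Definition _ := [isSub for sun_val].
HB.instance Definition _ := [Choice of sun by <:].
HB.instance Definition _ := [SubChoice_isSubLmodule of sun by <:].

Definition sun_norm (phi : sun) : K := `|sun_val phi|.

Lemma sun_normD phi psi : sun_norm (phi + psi) <= sun_norm phi + sun_norm psi.
Proof. exact: ler_normD. Qed.

Lemma sun_normZ (a : K) phi : sun_norm (a *: phi) = `|a| * sun_norm phi.
Proof. exact: normrZ. Qed.

Lemma sun_norm0 phi : sun_norm phi = 0 -> phi = 0.
Proof. by move=> /normr0_eq0 phi0; apply: val_inj. Qed.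

HB.instance Definition _ :=
  Lmodule_isNormed.Build K sun sun_normD sun_normZ sun_norm0.

Lemma sun_normE (phi : sun) : `|phi| = `|sun_val phi|.
Proof. by []. Qed.

Lemma adjoint_sun (t : R) (phi : sun) :
  0 <= t -> adjoint (T t) (sun_val phi) \in sun_pred.
Proof.
move=> t0; apply/sun_predP/cvgrPdist_le => e e0.
have /sun_predP/cvgrPdist_le phiP := sunP phi.
have M0 : 0 < `|T t| + 1 by rewrite ltr_wpDl.
near=> s.
have s0 : 0 <= s by near: s; exact: nbhs_right_ge.
have -> : adjoint (T s) (adjoint (T t) (sun_val phi)) =
    adjoint (T t) (adjoint (T s) (sun_val phi)).
  by apply: blin_eqP => x /=; rewrite -!semigroupD// addrC.
have -> : adjoint (T t) (sun_val phi) - adjoint (T t) (adjoint (T s) (sun_val phi))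
    = adjoint (T t) (sun_val phi - adjoint (T s) (sun_val phi)).
  exact: blin_eqP.
apply: (le_trans (adjoint_norm _ _)).
apply: (@le_trans _ _ ((`|T t| + 1) * (e / (`|T t| + 1)))); last first.
  by rewrite mulrC divfK// gt_eqF.
apply: ler_pM => //; first by rewrite lerDl.
by near: s; apply: phiP; rewrite divr_gt0.
Unshelve. all: by end_near. Qed.

(** [T^\odot(t)] is the restriction of [T^*(t)]; the value at [t < 0], which
   plays no role, is set to the value at [0]. *)
Lemma max0_ge0 (t : R) : 0 <= Num.max t 0.
Proof. by rewrite le_max lexx orbT. Qed.

Definition sun_fun (t : R) (phi : sun) : sun :=
  Sun (adjoint_sun phi (max0_ge0 t)).

Lemma sun_fun_linear (t : R) : linear (sun_fun t).
Proof. by move=> a phi psi; apply: val_inj; exact: adjointP. Qed.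

Lemma sun_fun_continuous (t : R) : continuous (sun_fun t).
Proof.
pose f := HB.pack_for {linear sun -> sun} (sun_fun t)
  (GRing.isLinear.Build K sun sun _ (sun_fun t) (@sun_fun_linear t)).
apply: (@bounded_linear_continuous _ _ _ f).
apply/linear_boundedP; exists `|T (Num.max t 0)|; split; first exact: normr_real.
move=> r /ltW Mr phi; apply: (le_trans (adjoint_norm _ _)).
by rewrite ler_wpM2r.
Qed.

Definition sun_op (t : R) : blin sun sun :=
  mk_blin (@sun_fun_linear t) (@sun_fun_continuous t).

Lemma sun_opE (t : R) (phi : sun) : 0 <= t ->
  sun_val (sun_op t phi) = adjoint (T t) (sun_val phi).
Proof. by move=> t0 /=; rewrite max_l. Qed.

Lemma sun_op0 (phi : sun) : sun_op 0 phi = phi.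
Proof.
apply: val_inj; change (sun_val (sun_op 0 phi) = sun_val phi).
by rewrite sun_opE//; apply: blin_eqP => x /=; rewrite semigroup0.
Qed.

Lemma sun_opD (s t : R) (phi : sun) : 0 <= s -> 0 <= t ->
  sun_op (s + t) phi = sun_op s (sun_op t phi).
Proof.
move=> s0 t0; apply: val_inj.
change (sun_val (sun_op (s + t) phi) = sun_val (sun_op s (sun_op t phi))).
rewrite !sun_opE ?addr_ge0//; apply: blin_eqP => x /=.
by rewrite addrC semigroupD.
Qed.

Lemma sun_op_cvg (phi : sun) : sun_op t phi @[t --> 0^'+] --> phi.
Proof.
have /sun_predP/cvgrPdist_le phiP := sunP phi.
apply/cvgrPdist_le => e e0; near=> t.
rewrite sun_normE -[sun_val _]/(sun_val phi - sun_val (sun_op t phi)).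
have t0 : 0 <= t by near: t; exact: nbhs_right_ge.
by rewrite sun_opE//; near: t; exact: phiP.
Unshelve. all: by end_near. Qed.

(** [T^\odot], the restriction of [T^*] to [X^\odot]. *)
Definition sun_semigroup : C0semigroup sun :=
  C0Semigroup sun_op0 sun_opD sun_op_cvg.

(** [\sigma(X^\odot, X)], the topology of pointwise convergence on [X]. *)
Definition sigma_sun :=
  initial_topology (fun phi : sun => (fun x => sun_val phi x) : {ptws X -> K^o}).

(** [\kappa^\odot] on [L(X^\odot)], the initial topology for the maps
    [V |-> <V phi, x>]. *)
Definition kappa_sun :=
  initial_topology (fun V : blin sun sun =>
    (fun p => sun_val (V p.1) p.2) : {ptws sun * X -> K^o}).

Lemma cvg_sigma_sun (F : set_system sun) (phi : sun) : Filter F ->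
  F --> (phi : sigma_sun) <->
  forall x, (sun_val psi x : K^o) @[psi --> F] --> (sun_val phi x : K^o).
Proof. by move=> FF; rewrite cvg_initial cvg_ptws. Qed.

Lemma cvg_kappa_sun (F : set_system (blin sun sun)) (V : blin sun sun) :
  Filter F ->
  F --> (V : kappa_sun) <->
  forall phi x,
    (sun_val (W phi) x : K^o) @[W --> F] --> (sun_val (V phi) x : K^o).
Proof.
move=> FF; rewrite cvg_initial cvg_ptws.
by split=> [FV phi x|FV [phi x]]; [exact: (FV (phi, x)) | exact: FV].
Qed.

End Sun.

(** A net is a family indexed by a directed preordered type; it converges to a
    point when it converges along the filter generated by the tails. *)
Definition directed (L : Type) (le : L -> L -> Prop) :=
  [/\ inhabited L, forall l, le l l,
      forall l1 l2 l3, le l1 l2 -> le l2 l3 -> le l1 l3 &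
      forall l1 l2, exists l, le l1 l /\ le l2 l].

Definition net_filter (L : Type) (le : L -> L -> Prop) : set_system L :=
  [set A | exists l0, forall l, le l0 l -> A l].

(* Main.v *)
From HB Require Import structures.
Require Import Defs.
From mathcomp Require Import all_boot all_order all_algebra.
From mathcomp Require Import complex ring lra.
From mathcomp Require Import all_classical all_reals all_analysis.

Set Implicit Arguments.
Unset Strict Implicit.
Unset Printing Implicit Defensive.

Import Order.TTheory GRing.Theory Num.Theory.
Import numFieldNormedType.Exports.

Local Open Scope classical_set_scope.
Local Open Scope ring_scope.

(** Along an ultrafilter finer than the neighbourhoods of [+oo], the bounded
    Cesaro means [C(r) phi] converge weak* (Banach-Alaoglu). Since
    [T^\odot(t) C(r) phi - C(r) phi] is [O(1/r)] in norm, the limit is fixed by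
    every [T^*(t)]; it is therefore automatically in [X^\odot], and in the kernel of
    [A^\odot]. Conversely, a boundedness argument shows that the elements of the
    kernel are fixed by the semigroup, hence by the Cesaro means and by the limit
    operator, which is thus a projection onto the kernel. *)

(** [X] need not be separable, so no single sequence of radii need serve every [phi]; an ultrafilter
    fixed before [phi] does, and uniqueness of limits then makes the limit linear in [phi]. An
    adjoint acts on the test vector, [<T^*(t) psi, x> = <psi, T(t) x>], which is why weak* limits
    can be compared with their images. The means are obtained from Riemann integrals by a choice
    operator, so nothing is known about them until the integral is shown to exist in [X^\odot]; the
    same weak* compactness provides it. The [O(1/r)] estimate is carried out on Riemann sums, where
    it is a cancellation in finite sums instead of a change of variables. *)

(** * Lengths of intersections of intervals *)

Section Overlap.
Context (R : realType).
Implicit Types (a b c d : R).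

(** Length of the intersection of [[a, b]] and [[c, d]], equal to 0 when they are disjoint. *)
Definition overlap a b c d := Num.max 0 (Num.min b d - Num.max a c).

Definition clamp a b y := Num.min b (Num.max a y).

Lemma overlapC a b c d : overlap a b c d = overlap c d a b.
Proof. by rewrite /overlap (minC b) (maxC a). Qed.

Lemma overlap_ge0 a b c d : 0 <= overlap a b c d.
Proof. by rewrite le_max lexx. Qed.

(** Writing the overlap as an increment of [clamp a b], the projection onto [[a, b]], makes its sum
    over a partition telescope. *)
Lemma overlap_clamp a b c d : a <= b -> c <= d ->
  overlap a b c d = clamp a b d - clamp a b c.
Proof.
rewrite /overlap /clamp => ab cd.
case/orP: (le_total d a) => [da|ad].
  rewrite (max_l da) (max_l (le_trans cd da)) (min_r ab) subrr.
  by apply: max_l; rewrite subr_le0 ge_min da orbT.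
case/orP: (le_total b c) => [bc|cb].
  rewrite (max_r (le_trans ab bc)) (min_l bc) (max_r ad) (min_l (le_trans bc cd)).
  by rewrite subrr; apply: max_l; rewrite subr_le0.
rewrite (max_r ad) [Num.min b (Num.max a c)]min_r ?ge_max ?ab//.
by apply: max_r; rewrite subr_ge0 le_min !ge_max ab cb ad cd.
Qed.

(** A nonzero overlap forces the intervals to meet, and a common point links [x] to [y]. *)
Lemma overlap_neq0 a b c d x y : overlap a b c d != 0 ->
  a <= x <= b -> c <= y <= d -> `|x - y| <= (b - a) + (d - c).
Proof.
rewrite /overlap /Order.min /Order.max => + /andP[ax xb] /andP[cy yd].
rewrite ler_distl; case: (ltP b d) (ltP a c) => ? [] ?.
all: case: ltP => ?; rewrite ?eqxx// => _; lra.
Qed.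

Lemma nondecreasing_initial (s : nat -> R) n i :
  (forall i, (i < n)%N -> s i <= s i.+1) -> (i <= n)%N -> s 0%N <= s i <= s n.
Proof.
move=> sn; elim: i => [_|i IH lin].
  rewrite lexx /=; elim: n sn => // n IHn sn.
  by rewrite (le_trans (IHn _) (sn _ _))// => i ni; apply: sn; rewrite ltnW.
apply/andP; split.
  by have /andP[/le_trans ->//] := IH (ltnW lin); exact: sn.
rewrite -(subnKC lin); move: (n - i.+1)%N (subnKC lin) => m mn.
elim: m {IH} n mn sn lin => [|m IHm] n mn sn lin; first by rewrite addn0.
rewrite addnS (le_trans (IHm (i.+1 + m)%N _ _ _))// ?leq_addr//.
  by move=> j jm; apply: sn; rewrite -mn addnS ltnS ltnW.
by apply: sn; rewrite -mn addnS.
Qed.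

Lemma sum_overlap a b (t : nat -> R) m : a <= b -> t 0%N <= a -> b <= t m ->
  (forall j, (j < m)%N -> t j <= t j.+1) ->
  \sum_(j < m) overlap a b (t j) (t j.+1) = b - a.
Proof.
move=> ab ta tb tm.
rewrite (eq_bigr (fun j : 'I_m => clamp a b (t j.+1) - clamp a b (t j))); last first.
  by move=> j _; rewrite overlap_clamp// tm.
rewrite -(big_mkord xpredT (fun j => clamp a b (t j.+1) - clamp a b (t j))).
rewrite telescope_sumr// /clamp (max_l ta) (min_r ab).
by rewrite (max_r (le_trans ab tb)) (min_l tb).
Qed.

End Overlap.

(** * Riemann sums and tagged partitions *)

Section RiemannSum.
Context (R : realType) (k : scalar_kind).
Local Notation K := (scalar_field R k).
Local Notation of_real := (of_real R k).
Variable Y : normedModType K.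
Implicit Types (f : R -> Y) (s t xi eta : nat -> R).

Definition Riemann_sum f n s xi : Y :=
  \sum_(i < n) of_real (s i.+1 - s i) *: f (xi i).

Definition tagged_partition (a b d : R) n s xi :=
  [/\ s 0%N = a, s n = b,
      forall i, (i < n)%N -> s i <= xi i <= s i.+1 &
      forall i, (i < n)%N -> s i.+1 - s i < d].

Definition uniformly_continuous_on (a b : R) f :=
  forall e : R, 0 < e -> exists2 d : R, 0 < d & forall x y,
    a <= x <= b -> a <= y <= b -> `|x - y| < d -> `|f x - f y| <= of_real e.

Lemma tagged_partition_le a b d n s xi : tagged_partition a b d n s xi ->
  forall i, (i < n)%N -> s i <= s i.+1.
Proof. by case=> _ _ sx _ i /sx /andP[]; exact: le_trans. Qed.

Lemma tagged_partition_tag a b d n s xi : tagged_partition a b d n s xi ->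
  forall i, (i < n)%N -> a <= xi i <= b.
Proof.
move=> P i lin; have sn := tagged_partition_le P; case: P => <- <- sx _.
have /andP[six xis] := sx i lin.
have /andP[si _] := nondecreasing_initial sn (ltnW lin).
have /andP[_ is'] := nondecreasing_initial sn lin.
by rewrite (le_trans si six) (le_trans xis is').
Qed.

Lemma normr_of_real (x : R) : 0 <= x -> `|of_real x| = of_real x.
Proof. by move=> x0; rewrite ger0_norm// of_real_ge0. Qed.

(* Both sums are written over the overlaps of the two partitions, which avoids
   forming a common refinement. *)
Lemma Riemann_sum_close f a b e : 0 < e -> a <= b ->
  uniformly_continuous_on a b f ->
  exists2 d : R, 0 < d & forall n s xi m t eta,
    tagged_partition a b d n s xi -> tagged_partition a b d m t eta ->
    `|Riemann_sum f n s xi - Riemann_sum f m t eta| <= of_real (e * (b - a)).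
Proof.
(* Two cells that meet, each shorter than [d / 2], have their tags within [d]. *)
move=> e0 ab /(_ _ e0)[d d0 fd]; exists (d / 2); first lra.
move=> n s xi m t eta Ps Pt.
have sn := tagged_partition_le Ps; have tm := tagged_partition_le Pt.
have xiab := tagged_partition_tag Ps; have etaab := tagged_partition_tag Pt.
case: Ps Pt => s0 sn_ sx sd [t0 tm_ tx td].
pose o i j := overlap (s i) (s i.+1) (t j) (t j.+1).
have so (i : 'I_n) : \sum_(j < m) o i j = s i.+1 - s i.
  apply: sum_overlap => //; rewrite ?sn//.
    by rewrite t0 -s0; have /andP[] := nondecreasing_initial sn (ltnW (ltn_ord i)).
  by rewrite tm_ -sn_; have /andP[] := nondecreasing_initial sn (ltn_ord i).
have to (j : 'I_m) : \sum_(i < n) o i j = t j.+1 - t j.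
  under eq_bigr do rewrite /o overlapC.
  apply: sum_overlap => //; rewrite ?tm//.
    by rewrite s0 -t0; have /andP[] := nondecreasing_initial tm (ltnW (ltn_ord j)).
  by rewrite sn_ -tm_; have /andP[] := nondecreasing_initial tm (ltn_ord j).
have -> : Riemann_sum f n s xi =
    \sum_(i < n) \sum_(j < m) of_real (o i j) *: f (xi i).
  by apply: eq_bigr => i _; rewrite -scaler_suml -rmorph_sum so.
have -> : Riemann_sum f m t eta =
    \sum_(i < n) \sum_(j < m) of_real (o i j) *: f (eta j).
  rewrite exchange_big; apply: eq_bigr => j _.
  by rewrite -scaler_suml -rmorph_sum to.
rewrite -sumrB; under eq_bigr do rewrite -sumrB.
(* The bound is spread over the same pairs of cells as the two sums, so the comparison is made pair
   by pair. *)
have -> : e * (b - a) = \sum_(i < n) \sum_(j < m) o i j * e.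
  under eq_bigr do rewrite -mulr_suml so.
  rewrite -mulr_suml mulrC; congr (_ * _).
  by rewrite -(big_mkord xpredT (fun i => s i.+1 - s i)) telescope_sumr// s0 sn_.
rewrite rmorph_sum; apply: (le_trans (ler_norm_sum _ _ _)); apply: ler_sum => i _.
rewrite rmorph_sum; apply: (le_trans (ler_norm_sum _ _ _)); apply: ler_sum => j _.
rewrite -scalerBr normrZ normr_of_real ?overlap_ge0// rmorphM.
have [->|oij] := eqVneq (o i j) 0; first by rewrite rmorph0 !mul0r.
rewrite ler_wpM2l ?of_real_ge0 ?overlap_ge0//.
apply: fd; [exact: xiab|exact: etaab|].
have := overlap_neq0 oij (sx i (ltn_ord i)) (tx j (ltn_ord j)).
by have := sd i (ltn_ord i); have := td j (ltn_ord j); lra.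
Qed.

Lemma Riemann_sum_norm f n s xi B :
  (forall i, (i < n)%N -> s i <= s i.+1) -> 0 <= B ->
  (forall i, (i < n)%N -> `|f (xi i)| <= of_real B) ->
  `|Riemann_sum f n s xi| <= of_real ((s n - s 0%N) * B).
Proof.
move=> sn B0 fB; apply: (le_trans (ler_norm_sum _ _ _)).
have -> : (s n - s 0%N) * B = \sum_(i < n) (s i.+1 - s i) * B.
  rewrite -mulr_suml; congr (_ * _).
  by rewrite -(big_mkord xpredT (fun i => s i.+1 - s i)) telescope_sumr.
rewrite rmorph_sum; apply: ler_sum => i _.
rewrite normrZ normr_of_real ?subr_ge0 ?sn// rmorphM.
by rewrite ler_wpM2l ?of_real_ge0 ?subr_ge0 ?sn// fB.
Qed.

Definition uniform_node (a b : R) n (i : nat) := a + (b - a) * i%:R / n%:R.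

Lemma uniform_partition a b d : 0 < d -> a <= b ->
  \forall n \near \oo, tagged_partition a b d n (uniform_node a b n) (uniform_node a b n).
Proof.
move=> d0 ab; exists (Num.truncn ((b - a) / d)).+1 => // n /= nd.
have n0 : 0 < n%:R :> R by rewrite ltr0n (leq_trans _ nd).
have nd' : (b - a) / d < n%:R.
  have /truncn_itv/andP[_ /lt_le_trans] : 0 <= (b - a) / d.
    by rewrite divr_ge0 ?subr_ge0// ltW.
  by apply; rewrite ler_nat.
have step i : uniform_node a b n i.+1 - uniform_node a b n i = (b - a) / n%:R.
  by rewrite /uniform_node -natr1; field; rewrite gt_eqF.
split.
- by rewrite /uniform_node mulr0 mul0r addr0.
- by rewrite /uniform_node mulfK ?gt_eqF// addrC subrK.
- by move=> i _; rewrite lexx -subr_ge0 step divr_ge0 ?subr_ge0// ltW.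
- by move=> i _; rewrite step ltr_pdivrMr// mulrC -ltr_pdivrMr.
Qed.

Lemma is_Riemann_integralP f a b I : is_Riemann_integral f a b I <->
  forall e : R, 0 < e -> exists2 d : R, 0 < d & forall n s xi,
    tagged_partition a b d n s xi -> `|Riemann_sum f n s xi - I| < of_real e.
Proof.
split=> fI e e0; have [d d0 H] := fI e e0; exists d => //.
  by move=> n s xi [*]; exact: H.
by move=> n s xi *; apply: H.
Qed.

End RiemannSum.

(** * Limits along ultrafilters, for scalars and for functionals *)

(** A cluster point of an ultrafilter is a limit: if the preimage of a neighbourhood [V] were not in
    [U], its complement would be, and clustering would give a point of [V] outside [V]. *)
Lemma ultra_compact_cvg (I : Type) (T : topologicalType) (U : set_system I)
    (A : set T) (f : I -> T) : UltraFilter U -> compact A ->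
  (\forall i \near U, A (f i)) -> exists l : T, f i @[i --> U] --> l.
Proof.
move=> UU cA UA; have [l [_ fl]] := cA (f @ U) _ UA.
exists l => V Vl; have [//|UV] := in_ultra_setVsetC (f @^-1` V) UU.
by have [y []] := fl (~` V) V UV Vl.
Qed.

Section UltraLimit.
Context (R : realType) (k : scalar_kind).
Local Notation K := (scalar_field R k).
Local Notation of_real := (of_real R k).

Lemma ltr_of_real (x y : R) : (of_real x < of_real y) = (x < y).
Proof. by case: k => //=; rewrite ltcR. Qed.

Lemma of_real_gt0 (x : R) : (0 < of_real x) = (0 < x).
Proof. by rewrite -{1}(rmorph0 of_real) ltr_of_real. Qed.

Lemma gt0_of_real (c : K) : 0 < c -> exists2 r : R, 0 < r & c = of_real r.
Proof.
by move=> c0; have [r _ E] := ge0_of_real (ltW c0); exists r => //; rewrite -of_real_gt0 -E.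
Qed.

Lemma cvg_of_realP (I : Type) (F : set_system I) (V : normedModType K)
    (f : I -> V) (l : V) : Filter F ->
  (f i @[i --> F] --> l) <->
  (forall e : R, 0 < e -> \forall i \near F, `|l - f i| <= of_real e).
Proof.
move=> FF; split=> [/cvgrPdist_le fl e e0|fl].
  by apply: fl; rewrite of_real_gt0.
by apply/cvgrPdist_le => _ /gt0_of_real[e e0 ->]; exact: fl.
Qed.

Lemma le_of_real_gt0 (x y : K) :
  (forall e : R, 0 < e -> x <= y + of_real e) -> x <= y.
Proof. by move=> xy; apply/ler_addgt0Pr => _ /gt0_of_real[e e0 ->]; exact: xy. Qed.

Lemma cvg_norm_le (I : Type) (F : set_system I) (V : normedModType K)
    (f : I -> V) (l c : V) (b : K) : ProperFilter F ->
  f i @[i --> F] --> l -> (\forall i \near F, `|c - f i| <= b) -> `|c - l| <= b.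
Proof.
move=> FF /cvg_of_realP fl cf; apply: le_of_real_gt0 => e e0.
have [i [fli ci]] : exists i, `|l - f i| <= of_real e /\ `|c - f i| <= b.
  by apply: (@filter_ex _ F); apply: filterI => //; exact: fl.
by rewrite (le_trans (ler_distD (f i) _ _))// lerD// distrC.
Qed.

End UltraLimit.

(** Compactness is invoked only for a real segment; complex values go through their real and
    imaginary parts, both dominated by the modulus. *)
Lemma bounded_ultra_cvg (R : realType) (k : scalar_kind) (I : Type)
    (U : set_system I) (f : I -> scalar_field R k) (B : R) : UltraFilter U ->
  (\forall i \near U, `|f i| <= of_real R k B) ->
  exists l : scalar_field R k,
    (f i : (scalar_field R k)^o) @[i --> U] --> (l : (scalar_field R k)^o).
Proof.
move=> UU; have real_case (g : I -> R) : (\forall i \near U, `|g i| <= B) ->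
    exists l : R, g i @[i --> U] --> l.
  move=> gB; apply: (ultra_compact_cvg UU (@segment_compact R (- B) B)).
  by apply: filterS gB => i; rewrite ler_norml /= in_itv.
case: k f => [|f fB]; first exact: real_case.
have Re_le (z : R[i]) : (`|complex.Re z|%:C)%C <= `|z| := normc_ge_Re z.
have Im_le (z : R[i]) : (`|complex.Im z|%:C)%C <= `|z|.
  by rewrite normc_def lecR -sqrtr_sqr ler_wsqrtr// lerDr sqr_ge0.
have [a fa] : exists a : R, complex.Re (f i) @[i --> U] --> a.
  by apply: real_case; apply: filterS fB => i /(le_trans (Re_le _)); rewrite lecR.
have [b fb] : exists b : R, complex.Im (f i) @[i --> U] --> b.
  by apply: real_case; apply: filterS fB => i /(le_trans (Im_le _)); rewrite lecR.
exists (Complex a b); apply/(@cvg_of_realP R ComplexScalars) => e e0.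
have e20 : 0 < e / 2 by rewrite divr_gt0.
move/cvgrPdist_le : fa => /(_ _ e20) fa; move/cvgrPdist_le : fb => /(_ _ e20) fb.
near=> i.
have -> : (Complex a b - f i : R[i]) =
    (a - complex.Re (f i))%:C%C + 'i%C * (b - complex.Im (f i))%:C%C.
  by rewrite [LHS]complexE; case: (f i).
apply: (le_trans (ler_normD _ _)).
rewrite normrM !normc_def /= !(expr0n, expr1n, add0r, addr0) sqrtr1 mul1r.
rewrite !sqrtr_sqr -rmorphD lecR (splitr e) lerD//; near: i; [exact: fa|exact: fb].
Unshelve. all: by end_near. Qed.

Section UltraDual.
Context (R : realType) (k : scalar_kind).
Local Notation K := (scalar_field R k).
Local Notation of_real := (of_real R k).

(* Banach-Alaoglu, in terms of ultrafilters. *)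
Lemma bounded_ultra_dual_cvg (X : normedModType K) (I : Type) (U : set_system I)
    (phi : I -> dual_space X) (B : R) : UltraFilter U -> 0 <= B ->
  (\forall i \near U, `|phi i| <= of_real B) ->
  exists2 psi : dual_space X, `|psi| <= of_real B &
    forall x, (phi i x : K^o) @[i --> U] -->
              (psi x : K^o).
Proof.
move=> UU B0 phiB.
have phix x : \forall i \near U, `|phi i x : K^o| <= of_real B * `|x|.
  apply: filterS phiB => i ?; rewrite (le_trans (le_opnorm _ _))// ler_wpM2r//.
have ex x : exists l : K, (phi i x : K^o) @[i --> U] --> (l : K^o).
  have [r r0 xr] := ge0_of_real (normr_ge0 x).
  by apply: (@bounded_ultra_cvg R k I U _ (B * r)); rewrite rmorphM -xr.
(* The pointwise limits, one for each [x], form the functional: linearity and the bound [B] pass to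
   the limit. *)
have /choice[l phil] := ex.
have ll : linear (l : X -> K^o).
  move=> a x y; apply: (@cvg_unique _ (@norm_hausdorff _ _) (phi i (a *: x + y) @[i --> U])).
    exact: phil.
  have -> : (fun i => phi i (a *: x + y) : K^o) =
      (fun i => a *: (phi i x : K^o) + phi i y).
    by apply/funext => i; exact: blin_linear.
  by apply: cvgD; [apply: cvgZl_tmp; exact: phil|exact: phil].
have lB x : `|l x : K^o| <= of_real B * `|x|.
  have := @cvg_norm_le R k I U K^o _ _ 0 (of_real B * `|x|) _ (phil x).
  rewrite sub0r normrN; apply; apply: filterS (phix x) => i.
  by rewrite sub0r normrN.
pose g := HB.pack_for {linear X -> K^o} (l : X -> K^o)
  (GRing.isLinear.Build K X K^o _ (l : X -> K^o) ll).
have cl : continuous (l : X -> K^o).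
  apply: (@bounded_linear_continuous _ _ _ g).
  apply/linear_boundedP; exists (of_real B); split.
    by rewrite realE of_real_ge0 B0.
  by move=> r /ltW Br x; rewrite (le_trans (lB x))// ler_wpM2r.
exists (mk_blin ll cl : dual_space X); last exact: phil.
by rewrite blin_normE ler_of_real; apply: opnorm_le.
Qed.

End UltraDual.

(** * Riemann integrals: uniqueness, linearity, norm bound *)

Section RiemannIntegral.
Context (R : realType) (k : scalar_kind).
Local Notation K := (scalar_field R k).
Local Notation of_real := (of_real R k).
Variable Y : normedModType K.
Implicit Types f g : R -> Y.

Lemma is_Riemann_integral_cvg f a b I : a <= b -> is_Riemann_integral f a b I ->
  Riemann_sum f n (uniform_node a b n) (uniform_node a b n) @[n --> \oo] --> I.
Proof.
move=> ab /is_Riemann_integralP fI; apply/cvg_of_realP => e e0.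
have [d d0 H] := fI e e0.
apply: filterS (uniform_partition d0 ab) => n /H /ltW.
by rewrite distrC.
Qed.

Lemma is_Riemann_integral_unique f a b I J : a <= b ->
  is_Riemann_integral f a b I -> is_Riemann_integral f a b J -> I = J.
Proof.
move=> ab /(is_Riemann_integral_cvg ab) fI /(is_Riemann_integral_cvg ab) fJ.
exact: (@cvg_unique _ (@norm_hausdorff _ _) _ _ _ _ fI fJ).
Qed.

Lemma is_Riemann_integral_comb f g a b (c : K) I J : a <= b ->
  is_Riemann_integral f a b I -> is_Riemann_integral g a b J ->
  is_Riemann_integral (fun s => c *: f s + g s) a b (c *: I + J).
Proof.
move=> ab /is_Riemann_integralP fI /is_Riemann_integralP gJ.
apply/is_Riemann_integralP => e e0.
have [r r0 cr] := ge0_of_real (normr_ge0 c).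
(* Dividing by [r + 1] instead of [r = |c|] also covers [c = 0]. *)
have e1 : 0 < e / (r + 1) by rewrite divr_gt0// ltr_wpDl.
have [d1 d10 H1] := fI _ (divr_gt0 e1 (ltr0n _ 2)).
have [d2 d20 H2] := gJ _ (divr_gt0 e0 (ltr0n _ 2)).
exists (Num.min d1 d2); first by rewrite lt_min d10 d20.
move=> n s xi [sa sb sx sd].
have P1 : tagged_partition a b d1 n s xi.
  by split=> // i /sd; rewrite lt_min => /andP[].
have P2 : tagged_partition a b d2 n s xi.
  by split=> // i /sd; rewrite lt_min => /andP[].
have -> : Riemann_sum (fun s => c *: f s + g s) n s xi =
    c *: Riemann_sum f n s xi + Riemann_sum g n s xi.
  rewrite /Riemann_sum scaler_sumr -big_split; apply: eq_bigr => i _ /=.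
  by rewrite scalerDr !scalerA mulrC.
rewrite opprD addrACA -scalerBr (le_lt_trans (ler_normD _ _))// normrZ cr.
have -> : e = e / 2 + e / 2 by field.
rewrite rmorphD ler_ltD ?H2//.
apply: (le_trans (ler_wpM2l _ (ltW (H1 _ _ _ P1)))); first by rewrite of_real_ge0.
have re : r * (e / (r + 1)) <= e.
  by rewrite mulrCA ler_piMr ?(ltW e0)// ler_pdivrMr ?mul1r ?lerDl ?ltr_wpDl.
by rewrite -rmorphM ler_of_real mulrA ler_wpM2r.
Qed.

Lemma is_Riemann_integral_norm f a b I B : a <= b -> 0 <= B ->
  (forall x, a <= x <= b -> `|f x| <= of_real B) ->
  is_Riemann_integral f a b I -> `|I| <= of_real ((b - a) * B).
Proof.
move=> ab B0 fB /(is_Riemann_integral_cvg ab) fI.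
have := @cvg_norm_le R k _ _ Y _ I 0 (of_real ((b - a) * B)) _ fI.
rewrite sub0r normrN; apply.
(* The mesh bound 1 is arbitrary: it only selects the [n] for which the nodes form a partition. *)
apply: filterS (uniform_partition (@ltr01 R) ab) => n P.
rewrite sub0r normrN; have [sa sb _ _] := P.
have := @Riemann_sum_norm _ _ _ f _ _ _ B (tagged_partition_le P) B0.
rewrite sa sb; apply => i lin; apply: fB; exact: (tagged_partition_tag P).
Qed.

Lemma is_Riemann_integral_cst (y : Y) a b :
  is_Riemann_integral (fun=> y) a b (of_real (b - a) *: y).
Proof.
apply/is_Riemann_integralP => e e0; exists 1 => // n s xi [sa sb _ _].
rewrite /Riemann_sum -scaler_suml -rmorph_sum.
rewrite -(big_mkord xpredT (fun i => s i.+1 - s i)) telescope_sumr// sa sb.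
by rewrite subrr normr0 of_real_gt0.
Qed.

End RiemannIntegral.

(** * Bounded semigroups: continuity, fixed vectors, shifted sums *)

Section BoundedSemigroup.
Context (R : realType) (k : scalar_kind).
Local Notation K := (scalar_field R k).
Local Notation of_real := (of_real R k).
Variables (Y : normedModType K) (S : C0semigroup Y) (M : R).
Hypotheses (M1 : 1 <= M)
  (SM : forall t y, 0 <= t -> `|S t y| <= of_real M * `|y|).

Let M0 : 0 < M. Proof. exact: lt_le_trans M1. Qed.

Lemma semigroup_small y (e : R) : 0 < e ->
  exists2 d : R, 0 < d & forall t, 0 <= t < d -> `|y - S t y| <= of_real e.
Proof.
move=> e0; have /cvg_of_realP/(_ e e0)[d /= d0 H] := semigroup_cvg S (y := y).
exists d => // t /andP[]; rewrite le_eqVlt => /predU1P[<- _|t0 td].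
  by rewrite semigroup0 subrr normr0 of_real_ge0 ltW.
by apply: H => //=; rewrite sub0r normrN gtr0_norm.
Qed.

(** For [s <= t], [S t y - S s y = S s (S (t - s) y - y)], so the bound [M] turns continuity at 0
    into uniform continuity. *)
Lemma semigroup_uniformly_continuous y a b : 0 <= a ->
  uniformly_continuous_on a b (fun t => S t y).
Proof.
move=> a0 e e0; have [d d0 H] := semigroup_small y (divr_gt0 e0 M0).
exists d => // s t; wlog st : s t / s <= t => [W|].
  case/orP: (le_total s t) => [|ts abs abt]; first exact: W.
  by rewrite distrC [leLHS]distrC; exact: W.
move=> /andP[/(le_trans a0) s0 _] _; rewrite distrC ger0_norm ?subr_ge0// => std.
have -> : S t y = S s (S (t - s) y) by rewrite -semigroupD ?subr_ge0// subrKC.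
rewrite -linearB (le_trans (SM _ s0))//.
have -> : of_real e = of_real M * of_real (e / M).
  by rewrite -rmorphM mulrC divfK// gt_eqF.
by rewrite ler_wpM2l ?of_real_ge0 ?(ltW M0)// H// subr_ge0 st.
Qed.

(** Telescoping: [S (n h) y - y] is the sum over [i < n] of [S (i h) (S h y - y)], each term of norm
    at most [M e]. *)
Lemma semigroup_iter_sub y h (e : R) n : 0 <= h -> `|S h y - y| <= of_real e ->
  `|S (n%:R * h) y - y| <= of_real (n%:R * (M * e)).
Proof.
move=> h0 he; elim: n => [|n IH].
  by rewrite !mul0r semigroup0 subrr normr0 rmorph0.
have nh0 : 0 <= n%:R * h by rewrite mulr_ge0.
rewrite -natr1 !mulrDl !mul1r semigroupD//.
rewrite -(subrKA (S (n%:R * h) y)) -linearB.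
rewrite (le_trans (ler_normD _ _))// addrC rmorphD lerD//.
by rewrite (le_trans (SM _ nh0))// rmorphM ler_wpM2l// of_real_ge0 ltW.
Qed.

(** If the derivative at 0 vanishes, then [S h y - y = o(h)]; reaching [t] in [n] steps of length
    [h = t / n] costs at most [n M o(h)], which tends to 0. The tolerance [e / (t * M)] makes this
    total exactly [e]. *)
Lemma null_space_fixed y : null_space (generator S) y <->
  forall t, 0 <= t -> S t y = y.
Proof.
split=> [|fixy]; last first.
  rewrite /null_space /generator /=; apply/cvg_of_realP => e e0; near=> h.
  have h0 : 0 <= h by near: h; exact: nbhs_right_ge.
  by rewrite fixy// subrr scaler0 subrr normr0 of_real_ge0 ltW.
move=> /cvg_of_realP y0 t; rewrite le_eqVlt => /predU1P[<-|t0].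
  by rewrite semigroup0.
apply/eqP; rewrite -subr_eq0 -normr_le0; apply: le_of_real_gt0 => e e0.
have e'0 : 0 < e / (t * M) by rewrite divr_gt0// mulr_gt0.
have [d /= d0 H] := y0 _ e'0.
pose n := (Num.truncn (t / d)).+1.
have n0 : 0 < n%:R :> R by rewrite ltr0n.
have nd : t / d < n%:R.
  by have /truncn_itv/andP[_] : 0 <= t / d by rewrite divr_ge0 ?ltW.
pose h := t / n%:R; have h0 : 0 < h by rewrite divr_gt0.
have : `|S h y - y| <= of_real (h * (e / (t * M))).
  have : `|0 - (of_real h)^-1 *: (S h y - y)| <= of_real (e / (t * M)).
    apply: H => //=; rewrite sub0r normrN gtr0_norm//.
    by rewrite ltr_pdivrMr// mulrC -ltr_pdivrMr.
  rewrite sub0r normrN normrZ normfV normr_of_real ?(ltW h0)//.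
  by rewrite ler_pdivrMl ?of_real_gt0// -rmorphM.
move=> /(semigroup_iter_sub n (ltW h0)).
have -> : n%:R * h = t by rewrite mulrC divfK ?gt_eqF.
move/le_trans; apply; rewrite add0r ler_of_real /h le_eqVlt; apply/orP; left.
by apply/eqP; field; rewrite !gt_eqF.
Unshelve. all: by end_near. Qed.

(** Discrete form of [\int_t^{r+t} - \int_0^r = \int_r^{r+t} - \int_0^t]. *)
Lemma sum_shiftB (V : zmodType) (G : nat -> V) n m :
  \sum_(i < n) G (m + i)%N - \sum_(i < n) G i =
  \sum_(i < m) G (n + i)%N - \sum_(i < m) G i.
Proof.
apply/eqP; rewrite subr_eq addrAC eq_sym subr_eq eq_sym; apply/eqP.
transitivity (\sum_(i < m + n) G i); first by rewrite big_split_ord addrC.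
by rewrite addnC big_split_ord addrC.
Qed.

(* For a partition of step [t / m] (only the last step may be shorter), [S t]
   shifts the sum by [m] nodes, so that all but [2 * m] terms cancel. *)
Lemma Riemann_sum_shift y (B : R) t r d : 0 < t -> 0 < r -> 0 < d ->
  `|y| <= of_real B -> exists n s,
    tagged_partition 0 r d n s s /\
    `|S t (Riemann_sum (fun u => S u y) n s s) - Riemann_sum (fun u => S u y) n s s|
      <= of_real (4 * t * (M * B)).
Proof.
move=> t0 r0 d0 yB.
have B0 : 0 <= B by rewrite -(of_real_ge0 k) (le_trans (normr_ge0 y)).
have SB u : 0 <= u -> `|S u y| <= of_real (M * B).
  move=> u0; rewrite (le_trans (SM _ u0))// rmorphM ler_wpM2l//.
  by rewrite of_real_ge0 ltW.
(* Exactly [m] steps of length [h = t / m < d] make up [t], so [S t] sends each [G i] to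
   [G (m + i)]. *)
pose m := (Num.truncn (t / d)).+1.
have m0 : 0 < m%:R :> R by rewrite ltr0n.
have md : t / d < m%:R.
  by have /truncn_itv/andP[_] : 0 <= t / d by rewrite divr_ge0 ?ltW.
pose h := t / m%:R; have h0 : 0 < h by rewrite divr_gt0.
have hd : h < d by rewrite ltr_pdivrMr// mulrC -ltr_pdivrMr.
have mh : m%:R * h = t by rewrite mulrC divfK ?gt_eqF.
have ht : h <= t by rewrite -mh ler_peMl ?ler1n ?ltW.
pose n := Num.truncn (r / h).
have /truncn_itv/andP[] : 0 <= r / h by rewrite divr_ge0 ?ltW.
rewrite -/n ler_pdivlMr// ltr_pdivrMr// => nr rn.
(* The nodes are the multiples of [h] up to [n h <= r], then [r] itself; the last cell has length in
   [[0, h)] and may be degenerate. *)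
pose s (i : nat) := if (i <= n)%N then i%:R * h else r.
have sS i : (i < n)%N -> s i.+1 - s i = h.
  by move=> lin; rewrite /s lin ltnW// -natr1 mulrDl mul1r addrAC subrr add0r.
have sn : s n.+1 - s n = r - n%:R * h by rewrite /s ltnn leqnn.
have step i : (i < n.+1)%N -> 0 <= s i.+1 - s i <= h.
  rewrite ltnS leq_eqVlt => /predU1P[->|/sS ->]; last by rewrite lexx ltW.
  rewrite sn subr_ge0 nr lerBlDr.
  by move: rn; rewrite -natr1 mulrDl mul1r addrC => /ltW.
exists n.+1, s; split.
  split; rewrite /s ?mul0r ?ltnn// -/s.
    by move=> i /step /andP[]; rewrite subr_ge0 lexx.
  by move=> i /step /andP[_ /le_lt_trans]; exact.
pose G (i : nat) := S (i%:R * h) y.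
have G2 i j : `|G i - G j| <= of_real (2 * (M * B)).
  rewrite mulrDl mul1r rmorphD (le_trans (ler_normB _ _))//.
  by rewrite lerD// SB// mulr_ge0// ltW.
have StG i : S t (G i) = G (m + i)%N.
  by rewrite /G natrD mulrDl mh semigroupD ?mulr_ge0// ltW.
have -> : Riemann_sum (fun u => S u y) n.+1 s s =
    of_real h *: (\sum_(i < n) G i) + of_real (s n.+1 - s n) *: G n.
  have SsG i : (i <= n)%N -> S (s i) y = G i by rewrite /s => ->.
  rewrite /Riemann_sum big_ord_recr /= SsG// scaler_sumr; congr (_ + _).
  by apply: eq_bigr => i _; rewrite sS// SsG// ltnW.
rewrite linearD !linearZ /= linear_sum StG opprD addrACA -!scalerBr.
rewrite (eq_bigr _ (fun (i : 'I_n) _ => StG i)).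
(* After cancellation [m] differences of weight [h] remain, and the last cell adds one of weight at
   most [h <= t]; each difference is at most [2 M B]. *)
rewrite sum_shiftB -sumrB (_ : 4 * t * (M * B) =
  h * (m%:R * (2 * (M * B))) + t * (2 * (M * B))); last by rewrite -mh; ring.
rewrite [leRHS]rmorphD (le_trans (ler_normD _ _))//.
apply: lerD; rewrite normrZ [leRHS]rmorphM.
  rewrite normr_of_real ?(ltW h0)// ler_wpM2l ?of_real_ge0 ?(ltW h0)//.
  rewrite (le_trans (ler_norm_sum _ _ _))//.
  apply: (le_trans (ler_sum _ (fun i _ => G2 _ _))).
  by rewrite sumr_const card_ord -rmorphMn [in leRHS]mulr_natl.
have /andP[s0 sh] := step n (ltnSn n).
rewrite normr_of_real// ler_pM ?of_real_ge0// ler_of_real.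
exact: le_trans sh ht.
Qed.

End BoundedSemigroup.

(** * Cesaro means of a bounded semigroup *)

Section CesaroMean.
Context (R : realType) (k : scalar_kind).
Local Notation K := (scalar_field R k).
Local Notation of_real := (of_real R k).
Variables (Y : normedModType K) (S : C0semigroup Y) (M : R).
Hypotheses (M1 : 1 <= M)
  (SM : forall t y, 0 <= t -> `|S t y| <= of_real M * `|y|)
  (S_integral : forall y r, 0 < r ->
    exists I, is_Riemann_integral (fun s => S s y) 0 r I).

Let M0 : 0 < M. Proof. exact: lt_le_trans M1. Qed.

(** [cesaro_mean] is selected by [xget], so it could be the default 0 until a bounded operator with
    the defining property is exhibited: the integral is linear in the vector by uniqueness, and
    bounded by [r M]. *)
Lemma cesaro_mean_integral r y : 0 < r ->
  is_Riemann_integral (fun s => S s y) 0 r (of_real r *: cesaro_mean S r y).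
Proof.
move=> r0; have r0' := ltW r0.
have /choice[I SI] := fun y => S_integral y r0.
have Il : linear I.
  move=> a x z; apply: (is_Riemann_integral_unique r0' (SI _)).
  have := is_Riemann_integral_comb a r0' (SI x) (SI z).
  rewrite (_ : (fun s => _) = (fun s => S s (a *: x + z)))//.
  by apply/funext => s; rewrite linearP.
have IM x : `|I x| <= of_real (r * M) * `|x|.
  have [b b0 xb] := ge0_of_real (normr_ge0 x).
  rewrite xb -rmorphM -mulrA -[r in r * _]subr0.
  apply: is_Riemann_integral_norm (SI x); rewrite ?mulr_ge0 ?(ltW M0)//.
  by move=> s /andP[s0 _]; rewrite rmorphM -xb SM.
have Cl : linear (fun x => (of_real r)^-1 *: I x).
  by move=> a x z; rewrite Il scalerDr !scalerA mulrC.
pose g := HB.pack_for {linear Y -> Y} (fun x => (of_real r)^-1 *: I x)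
  (GRing.isLinear.Build K Y Y _ (fun x => (of_real r)^-1 *: I x) Cl).
have Cc : continuous (fun x => (of_real r)^-1 *: I x).
  apply: (@bounded_linear_continuous _ _ _ g).
  apply/linear_boundedP; exists (of_real M); split.
    by rewrite realE of_real_ge0 ltW.
  move=> m /ltW Mm x; rewrite /g/= normrZ normfV normr_of_real//.
  rewrite ler_pdivrMl ?of_real_gt0// (le_trans (IM x))// rmorphM -mulrA.
  by rewrite ler_wpM2l ?of_real_ge0// ler_wpM2r.
have r_neq0 : of_real r != 0 by rewrite gt_eqF ?of_real_gt0.
have /(_ y)[J SJ ->] : [set C : blin Y Y | forall y, exists2 I,
    is_Riemann_integral (fun s => S s y) 0 r I & C y = (of_real r)^-1 *: I]
    (cesaro_mean S r).
  by apply: xgetPex; exists (mk_blin Cl Cc) => x; exists (I x).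
by rewrite scalerA mulfV// scale1r.
Qed.

Lemma cesaro_mean_norm r y : 0 < r ->
  `|cesaro_mean S r y| <= of_real M * `|y|.
Proof.
move=> r0; have [b b0 yb] := ge0_of_real (normr_ge0 y).
have Mb0 : 0 <= M * b by rewrite mulr_ge0// ltW.
have bound x : 0 <= x <= r -> `|S x y| <= of_real (M * b).
  by move=> /andP[x0 _]; rewrite rmorphM -yb SM.
have := is_Riemann_integral_norm (ltW r0) Mb0 bound (cesaro_mean_integral y r0).
rewrite subr0 normrZ (normr_of_real _ (ltW r0)) rmorphM.
by rewrite ler_pM2l ?of_real_gt0// rmorphM -yb.
Qed.

Lemma cesaro_mean_fixed r y : 0 < r -> (forall t, 0 <= t -> S t y = y) ->
  cesaro_mean S r y = y.
Proof.
move=> r0 Sy; have r_neq0 : of_real r != 0 by rewrite gt_eqF ?of_real_gt0.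
apply: (scalerI r_neq0).
have := is_Riemann_integral_cst (k := k) y 0 r; rewrite subr0.
apply: (is_Riemann_integral_unique (ltW r0)) => e e0.
have [d d0 H] := cesaro_mean_integral y r0 e0.
exists d => // n s xi s0 sn sx sd.
(* [S u y = y] is known only for [u >= 0], so the constant and the orbit are compared at the tags,
   which lie in [[0, r]]. *)
rewrite (eq_bigr (fun i : 'I_n => of_real (s i.+1 - s i) *: S (xi i) y)).
  exact: H.
move=> i _; rewrite Sy//.
have P : tagged_partition 0 r d n s xi by [].
by have /andP[] := tagged_partition_tag P (ltn_ord i).
Qed.

Lemma cesaro_mean_shift t y : 0 < t -> exists2 c : R, 0 <= c & forall r, 0 < r ->
  `|S t (cesaro_mean S r y) - cesaro_mean S r y| <= of_real (c / r).
Proof.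
move=> t0; have [b b0 yb] := ge0_of_real (normr_ge0 y).
have yb' : `|y| <= of_real b by rewrite yb.
(* The first term bounds the shift of a Riemann sum. Replacing the integral by a sum at distance at
   most 1 costs [M] under [S t] and 1 outside; after division by [r] this crude error is
   harmless. *)
exists (4 * t * (M * b) + (M + 1)).
  by rewrite addr_ge0 ?mulr_ge0 ?(ltW t0) ?(ltW M0)// addr_ge0// ltW.
move=> r r0; have /is_Riemann_integralP/(_ _ ltr01)[d d0 H] := cesaro_mean_integral y r0.
have [n [s [P SP]]] := Riemann_sum_shift M1 SM t0 r0 d0 yb'.
have /ltW {H} := H _ _ _ P; rewrite rmorph1.
move: SP; set Z := Riemann_sum _ _ _ _; set I := of_real r *: _ => SP ZI.
have -> : S t (cesaro_mean S r y) - cesaro_mean S r y = (of_real r)^-1 *: (S t I - I).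
  rewrite /I linearZ /= -scalerBr scalerA mulVf ?scale1r//.
  by rewrite gt_eqF ?of_real_gt0.
rewrite normrZ normfV (normr_of_real _ (ltW r0)) mulrC.
rewrite ler_pdivrMr ?of_real_gt0// -rmorphM divfK ?gt_eqF//.
have -> : S t I - I = S t (I - Z) + ((S t Z - Z) + (Z - I)).
  by rewrite linearB subrKA subrKA.
have -> : 4 * t * (M * b) + (M + 1) = M + (4 * t * (M * b) + 1) by ring.
rewrite !rmorphD rmorph1 (le_trans (ler_normD _ _))//.
apply: lerD; last by rewrite (le_trans (ler_normD _ _))// lerD.
rewrite (le_trans (SM _ (ltW t0)))// distrC.
by rewrite ler_piMr// of_real_ge0 ltW.
Qed.

End CesaroMean.

(** * Closedness of [X^\odot] and integration in it *)

Section SunIntegral.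
Context (R : realType) (k : scalar_kind).
Local Notation K := (scalar_field R k).
Local Notation of_real := (of_real R k).
Variables (X : normedModType K) (T : C0semigroup X) (M : R).
Hypotheses (M1 : 1 <= M) (TM : forall t, 0 <= t -> `|T t| <= of_real M).

Let M0 : 0 < M. Proof. exact: lt_le_trans M1. Qed.

Lemma adjointB (V : blin X X) (phi psi : dual_space X) :
  adjoint V (phi - psi) = adjoint V phi - adjoint V psi.
Proof. exact: blin_eqP. Qed.

Lemma sun_closed (psi : dual_space X) :
  (forall e : R, 0 < e -> exists phi : sun T, `|sun_val phi - psi| <= of_real e) ->
  psi \in sun_pred T.
Proof.
move=> H; apply/sun_predP/cvg_of_realP => e e0.
(* The three terms of the estimate below take 1, 1 and [M] shares of [e / (M + 2)]. *)
have e'0 : 0 < e / (M + 2) by rewrite divr_gt0// addr_gt0.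
have [phi phie] := H _ e'0.
have /sun_predP/cvg_of_realP/(_ _ e'0) phiT := sunP phi.
near=> t; have t0 : 0 <= t by near: t; exact: nbhs_right_ge.
have -> : psi - adjoint (T t) psi = (psi - sun_val phi) +
    ((sun_val phi - adjoint (T t) (sun_val phi)) + adjoint (T t) (sun_val phi - psi)).
  by rewrite adjointB addrA subrKA subrKA.
have -> : e = e / (M + 2) + (e / (M + 2) + M * (e / (M + 2))).
  by field; rewrite gt_eqF// addr_gt0.
rewrite !rmorphD (le_trans (ler_normD _ _))// lerD//; first by rewrite distrC.
rewrite (le_trans (ler_normD _ _))// lerD//; first by near: t.
rewrite (le_trans (adjoint_norm _ _))// rmorphM.
by rewrite ler_pM// TM.
Unshelve. all: by end_near. Qed.

(* The norm limit of Riemann sums is identified as their weak* limit along an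
   ultrafilter; this replaces the completeness of [X^\odot]. *)
Lemma sun_integral_exists (f : R -> sun T) a b : a <= b ->
  uniformly_continuous_on a b f -> exists I, is_Riemann_integral f a b I.
Proof.
move=> ab fc.
have [U [UU ooU]] := ultraFilterLemma (F := (\oo : set_system nat)) _.
pose Z n := Riemann_sum f n (uniform_node a b n) (uniform_node a b n).
(* All sums over fine enough uniform partitions lie within [b - a] of a single one of them,
   [Z n0]. *)
have [B B0 ZB] : exists2 B : R, 0 <= B & \forall n \near U, `|sun_val (Z n)| <= of_real B.
  have [d d0 H] := Riemann_sum_close ltr01 ab fc.
  have Pd := uniform_partition d0 ab.
  have [n0 Pn0] := filter_ex Pd.
  have [c c0 Zc] := ge0_of_real (normr_ge0 (Z n0)).
  exists (1 * (b - a) + c); first by rewrite addr_ge0 ?mul1r ?subr_ge0.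
  apply: ooU; apply: filterS Pd => n Pn.
  rewrite -[leLHS]/(`|Z n|) -(subrK (Z n0) (Z n)) (le_trans (ler_normD _ _))//.
  by rewrite rmorphD lerD ?Zc//; exact: H.
have [psi _ Zpsi] := bounded_ultra_dual_cvg UU B0 ZB.
(* At each [x] the Cauchy estimate passes to the limit along [U]; being proportional to the norm of
   [x], it becomes an estimate in norm. *)
have close e : 0 < e -> exists2 d : R, 0 < d & forall n s xi,
    tagged_partition a b d n s xi ->
    `|sun_val (Riemann_sum f n s xi) - psi| <= of_real (e * (b - a)).
  move=> e0; have [d d0 H] := Riemann_sum_close e0 ab fc.
  exists d => // n s xi P; rewrite blin_normE ler_of_real; apply: opnorm_le.
    by rewrite mulr_ge0 ?subr_ge0// ltW.
  move=> x; apply: (@cvg_norm_le R k _ U K^o _ _ _ _ _ (Zpsi x)).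
  apply: (@filterS _ U _ _ _ _ (ooU _ (uniform_partition d0 ab))) => m Pm.
  apply: (le_trans (le_opnorm (sun_val (Riemann_sum f n s xi) - sun_val (Z m)) x)).
  by rewrite ler_wpM2r// -blin_normE; exact: H.
(* The divisor [b - a + 1] is positive and keeps the inequality strict even if [a = b]. *)
have [e' e'0 e'E] : exists2 e' : R -> R,
    forall e, 0 < e -> 0 < e' e & forall e, 0 < e -> e' e * (b - a) < e.
  have c0 : 0 < b - a + 1 by rewrite ltr_wpDl ?subr_ge0.
  exists (fun e => e / (b - a + 1)) => e e0; first by rewrite divr_gt0.
  by rewrite mulrAC ltr_pdivrMr// ltr_pM2l// ltrDl.
have psi_sun : psi \in sun_pred T.
  apply: sun_closed => e e0; have [d d0 H] := close _ (e'0 e e0).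
  have [n /H Hn] := filter_ex (uniform_partition d0 ab).
  by exists (Z n); rewrite (le_trans Hn)// ler_of_real ltW// e'E.
exists (Sun psi_sun); apply/is_Riemann_integralP => e e0.
have [d d0 H] := close _ (e'0 e e0); exists d => // n s xi /H Hn.
by rewrite (le_lt_trans Hn)// ltr_of_real e'E.
Qed.

Lemma sun_semigroup_norm t (phi : sun T) : 0 <= t ->
  `|sun_semigroup T t phi| <= of_real M * `|phi|.
Proof.
move=> t0; rewrite -[leLHS]/(`|sun_val (sun_op T t phi)|) sun_opE//.
by rewrite (le_trans (adjoint_norm _ _))// ler_wpM2r// TM.
Qed.

End SunIntegral.

(** * From an ultrafilter on the radii to a net *)

Section UltraNet.
Context (R : realType) (U : set_system R).
Hypotheses (UU : UltraFilter U) (U_pos : U [set r | 0 < r]).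

(* Indexing by a point together with a member of [U] containing it makes every
   member of [U] contain a tail. *)
Record ultra_index := UltraIndex {
  index_point : R; index_set : set R;
  index_setU : U index_set; index_mem : index_set index_point;
  index_gt0 : 0 < index_point }.

Definition ultra_le (p q : ultra_index) := index_set q `<=` index_set p.

Lemma ultra_set_index A : U A -> exists p : ultra_index, index_set p = A.
Proof.
move=> UA; have [r [Ar r0]] := filter_ex (filterI UA U_pos).
by exists (UltraIndex UA Ar r0).
Qed.

Lemma ultra_le_directed : directed ultra_le.
Proof.
split.
- by have [p _] := ultra_set_index filterT; exists.
- by move=> p; exact: subset_refl.
- by move=> p q s pq qs; exact: subset_trans qs pq.
- move=> p q; have [s sE] := ultra_set_index (filterI (index_setU p) (index_setU q)).
  by exists s; rewrite /ultra_le sE; split=> x [].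
Qed.

Lemma ultra_net_cvg : index_point @ net_filter ultra_le --> U.
Proof.
move=> A UA; have [p pA] := ultra_set_index UA.
by exists p => q pq; rewrite -pA; apply: pq; exact: index_mem.
Qed.

End UltraNet.

Lemma net_filter_filter (L : Type) (le : L -> L -> Prop) :
  directed le -> Filter (net_filter le).
Proof.
move=> [[l] _ letr ledir]; split; first by exists l.
  move=> A B [a aA] [b bB]; have [c [ac bc]] := ledir a b.
  by exists c => d cd; split; [apply: aA|apply: bB]; apply: letr cd.
by move=> A B AB [a aA]; exists a => b /aA /AB.
Qed.

(** * The limit of the Cesaro means along the ultrafilter *)

Section SunMeanLimit.
Context (R : realType) (k : scalar_kind).
Local Notation K := (scalar_field R k).
Local Notation of_real := (of_real R k).
Variables (X : normedModType K) (T : C0semigroup X) (M : R).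
Hypotheses (M1 : 1 <= M) (TM : forall t, 0 <= t -> `|T t| <= of_real M).
Variable U : set_system R.
Hypotheses (UU : UltraFilter U) (ooU : +oo%R `<=` U).

Let S := sun_semigroup T.
Let C r (phi : sun T) : sun T := cesaro_mean S r phi.

Let M_gt0 : 0 < M. Proof. exact: lt_le_trans M1. Qed.

Let U_pos : U [set r | 0 < r].
Proof. by apply: ooU; exact: nbhs_pinfty_gt. Qed.

Let SM t phi : 0 <= t -> `|S t phi| <= of_real M * `|phi|.
Proof. by move=> t0; exact: sun_semigroup_norm. Qed.

Let S_integral phi r : 0 < r ->
  exists I, is_Riemann_integral (fun s => S s phi) 0 r I.
Proof.
move=> r0; apply: (sun_integral_exists M1 TM (ltW r0)).
exact: (semigroup_uniformly_continuous M1 SM).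
Qed.

Lemma sun_mean_norm r phi : 0 < r -> `|C r phi| <= of_real M * `|phi|.
Proof. exact: cesaro_mean_norm. Qed.

(** The limit is sought in the whole dual, where compactness provides it; membership in [X^\odot]
    comes afterwards. *)
Definition mean_limit (phi : sun T) (psi : dual_space X) :=
  forall x, (sun_val (C r phi) x : K^o) @[r --> U] --> (psi x : K^o).

Lemma mean_limit_unique phi psi1 psi2 :
  mean_limit phi psi1 -> mean_limit phi psi2 -> psi1 = psi2.
Proof.
move=> C1 C2; apply: blin_eqP => x.
exact: (@cvg_unique _ (@norm_hausdorff _ K^o) _ _ _ _ (C1 x) (C2 x)).
Qed.

(** Along [U], [<C(r) phi, T(t) x>] tends to [psi (T t x)] and also, since it differs from
    [<C(r) phi, x>] by [O(1/r)], to [psi x]. *)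
Lemma mean_limit_fixed phi psi t : mean_limit phi psi -> 0 <= t ->
  adjoint (T t) psi = psi.
Proof.
move=> Cpsi; rewrite le_eqVlt => /predU1P[<-|t0].
  by apply: blin_eqP => x /=; rewrite semigroup0.
apply: blin_eqP => x.
apply: (@cvg_unique _ (@norm_hausdorff _ K^o) (sun_val (C r phi) (T t x) @[r --> U])).
  exact: Cpsi.
apply/cvg_of_realP => e e0.
have e20 : 0 < e / 2 by rewrite divr_gt0.
have [c c0 Cc] := cesaro_mean_shift M1 SM S_integral phi t0.
have [b b0 xb] := ge0_of_real (normr_ge0 x).
move/cvg_of_realP : (Cpsi x) => /(_ _ e20) Ce.
(* Beyond this radius the shift error [c b / r] is at most [e / 2]. *)
have Ur : U [set r | c * b / (e / 2) < r].
  by apply: ooU; apply: nbhs_pinfty_gt; exact: num_real.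
near=> r.
have r0 : 0 < r by near: r.
have -> : psi x - sun_val (C r phi) (T t x) =
    (psi x - sun_val (C r phi) x) + - sun_val (S t (C r phi) - C r phi) x.
  rewrite -[sun_val (S t _ - _) x]/
    (sun_val (sun_op T t (C r phi)) x - sun_val (C r phi) x).
  by rewrite sun_opE ?ltW//= opprB subrKA.
rewrite (splitr e) rmorphD (le_trans (ler_normD _ _))//.
apply: lerD; first by near: r.
rewrite normrN (le_trans (le_opnorm (sun_val (S t (C r phi) - C r phi)) x))//.
have := Cc _ r0; rewrite sun_normE blin_normE xb.
move: (opnorm _) => c' /(ler_wpM2r (_ : 0 <= of_real b))/le_trans; apply.
  by rewrite of_real_ge0.
rewrite -rmorphM ler_of_real mulrAC ler_pdivrMr// [leRHS]mulrC -ler_pdivrMr//.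
by apply: ltW; near: r.
Unshelve. all: by end_near. Qed.

Lemma fixed_sun (psi : dual_space X) :
  (forall t, 0 <= t -> adjoint (T t) psi = psi) -> psi \in sun_pred T.
Proof.
move=> psiT; apply/sun_predP/cvg_of_realP => e e0; near=> t.
have t0 : 0 <= t by near: t; exact: nbhs_right_ge.
by rewrite psiT// subrr normr0 of_real_ge0 ltW.
Unshelve. all: by end_near. Qed.

Lemma mean_limit_exists phi : exists psi : sun T, mean_limit phi (sun_val psi).
Proof.
have [b b0 phib] := ge0_of_real (normr_ge0 phi).
have Mb0 : 0 <= M * b by rewrite mulr_ge0// ltW.
have CM : \forall r \near U, `|sun_val (C r phi)| <= of_real (M * b).
  by apply: filterS U_pos => r r0; rewrite rmorphM -phib; exact: sun_mean_norm.
have [psi _ Cpsi] := bounded_ultra_dual_cvg UU Mb0 CM.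
by exists (Sun (fixed_sun (fun t => mean_limit_fixed Cpsi))).
Qed.

Lemma mean_limit_null phi (psi : sun T) : mean_limit phi (sun_val psi) ->
  null_space (generator S) psi.
Proof.
move=> Cpsi; apply/(null_space_fixed M1 SM) => t t0; apply: val_inj.
rewrite -[LHS]/(sun_val (sun_op T t psi)) sun_opE//.
exact: mean_limit_fixed Cpsi t0.
Qed.

Lemma null_mean_limit phi : null_space (generator S) phi ->
  mean_limit phi (sun_val phi).
Proof.
move=> /(null_space_fixed M1 SM) phiS x.
apply/cvg_of_realP => e e0; apply: filterS U_pos => r r0.
by rewrite /C (cesaro_mean_fixed M1 SM S_integral)// subrr normr0 of_real_ge0 ltW.
Qed.

Lemma mean_limit_comb a phi1 phi2 psi1 psi2 :
  mean_limit phi1 psi1 -> mean_limit phi2 psi2 ->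
  mean_limit (a *: phi1 + phi2) (a *: psi1 + psi2).
Proof.
move=> C1 C2 x.
have -> : (fun r => sun_val (C r (a *: phi1 + phi2)) x : K^o) =
    (fun r => a *: (sun_val (C r phi1) x : K^o) + sun_val (C r phi2) x).
  by apply/funext => r; rewrite /C linearP.
change (a *: (sun_val (C r phi1) x : K^o) + sun_val (C r phi2) x @[r --> U] -->
  (a *: (psi1 x : K^o) + psi2 x : K^o)).
by apply: cvgD; [apply: cvgZl_tmp; exact: C1|exact: C2].
Qed.

Lemma mean_limit_norm phi psi : mean_limit phi psi ->
  `|psi| <= of_real M * `|phi|.
Proof.
move=> Cpsi; have [b b0 phib] := ge0_of_real (normr_ge0 phi).
rewrite phib -rmorphM blin_normE ler_of_real.
apply: opnorm_le; first by rewrite mulr_ge0// ltW.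
move=> x; have := @cvg_norm_le R k _ U K^o _ _ 0 (of_real (M * b) * `|x|) _ (Cpsi x).
rewrite sub0r normrN; apply; apply: filterS U_pos => r r0.
rewrite sub0r normrN (le_trans (le_opnorm (sun_val (C r phi)) x))//.
by rewrite ler_wpM2r// -blin_normE rmorphM -phib; exact: sun_mean_norm.
Qed.

(** Uniqueness of limits along the fixed [U] makes the selected limits linear in [phi]; the uniform
    bound [M] gives continuity. *)
Lemma mean_limit_operator :
  exists Q : blin (sun T) (sun T), forall phi, mean_limit phi (sun_val (Q phi)).
Proof.
have /choice[Q CQ] := mean_limit_exists.
have Ql : linear Q.
  move=> a phi1 phi2; apply: val_inj.
  change (sun_val (Q (a *: phi1 + phi2)) =
    a *: sun_val (Q phi1) + sun_val (Q phi2)).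
  exact: mean_limit_unique (CQ _) (mean_limit_comb (CQ phi1) (CQ phi2)).
pose q := HB.pack_for {linear sun T -> sun T} Q
  (GRing.isLinear.Build K _ _ _ Q Ql).
have Qc : continuous Q.
  apply: (@bounded_linear_continuous _ _ _ q).
  apply/linear_boundedP; exists (of_real M); split.
    by rewrite realE of_real_ge0 ltW.
  move=> r /ltW Mr phi; rewrite (le_trans (mean_limit_norm (CQ phi)))//.
  by rewrite ler_wpM2r.
by exists (mk_blin Ql Qc).
Qed.

End SunMeanLimit.

Theorem corollary10p1 (R : realType) (k : scalar_kind)
    (X : completeNormedModType (scalar_field R k)) (T : C0semigroup X) :
  bounded_semigroup T ->
  exists (L : Type) (le : L -> L -> Prop) (r : L -> R),
    [/\ directed le,
        forall l, 0 < r l,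
        forall phi : sun T, exists2 psi : sun T,
          cesaro_mean (sun_semigroup T) (r l) phi @[l --> net_filter le]
            --> (psi : sigma_sun T) &
          null_space (generator (sun_semigroup T)) psi &
        exists Q : blin (sun T) (sun T),
          [/\ cesaro_mean (sun_semigroup T) (r l) @[l --> net_filter le]
                --> (Q : kappa_sun T),
              forall phi, Q (Q phi) = Q phi &
              range Q = null_space (generator (sun_semigroup T))]].
Proof.
move=> [M0 TM0].
(* [M0] is a scalar of the field; it is real because it dominates a norm. *)
have [m m0 Mm] : exists2 m : R, 0 <= m & M0 = of_real R k m.
  by apply: ge0_of_real; exact: le_trans (normr_ge0 _) (TM0 0 (lexx 0)).
(* Enlarging the bound to at least 1 makes it positive, so that it can be divided by. *)
pose M := Num.max 1 m.
have M1 : 1 <= M by rewrite le_max lexx.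
have TM t : 0 <= t -> `|T t| <= of_real R k M.
  by move=> /TM0/le_trans; apply; rewrite Mm ler_of_real le_max lexx orbT.
have [U [UU ooU]] := ultraFilterLemma (F := (+oo%R : set_system R)) _.
have U_pos : U [set r | 0 < r] by apply: ooU; exact: nbhs_pinfty_gt.
have [Q CQ] := mean_limit_operator M1 TM UU ooU.
have Q_null phi : null_space (generator (sun_semigroup T)) (Q phi).
  exact (mean_limit_null M1 TM UU ooU (CQ phi)).
have Q_fixed phi : null_space (generator (sun_semigroup T)) phi -> Q phi = phi.
  move=> /(null_mean_limit M1 TM UU ooU) Cphi; apply: val_inj.
  exact (mean_limit_unique UU (CQ phi) Cphi).
have dir := ultra_le_directed UU U_pos.
have NF := net_filter_filter dir.
exists (ultra_index U), (@ultra_le R U), (@index_point R U); split => //.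
- exact: index_gt0.
- move=> phi; exists (Q phi) => //; apply/cvg_sigma_sun => x.
  (* The image of the tail filter under [index_point] is finer than [U], so limits along [U] are
     limits of the net. *)
  exact: cvg_trans (cvg_app _ (ultra_net_cvg UU U_pos)) (CQ phi x).
exists Q; split.
- apply/cvg_kappa_sun => phi x.
  exact: cvg_trans (cvg_app _ (ultra_net_cvg UU U_pos)) (CQ phi x).
- by move=> phi; exact: Q_fixed.
- apply/seteqP; split=> [_ [phi _ <-]|phi phiN]; first exact: Q_null.
  by exists phi => //; exact: Q_fixed.
Qed.
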